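(* Let $n\ge\lceil\exp(\exp(\exp(20)))\rceil$ be an integer. There exist a two-dimensional linear subspace $W\subset\mathbb R^n$ and a vector $v\in W$ such that $$E(v,W)\ge\frac{1}{16e^2}\log\log\log n.$$
   Context: $\sigma(t)=1/(1+e^{-t})$. For $v\in\mathbb R^n$ and $\varepsilon\in\{-1,1\}^n$ let $p_v(\varepsilon)=\prod_{i=1}^n\sigma(\varepsilon_iv_i)$, which is a probability mass function on $\{-1,1\}^n$. For a subspace $W\subset\mathbb R^n$, let $\Gamma_W(\varepsilon;v)=\sup_{w\in W}\log\frac{p_w(\varepsilon)}{p_v(\varepsilon)}$ and $$E(v,W)=\mathbf E_{\varepsilon\sim p_v}\Gamma_W(\varepsilon;v)=\sum_{\varepsilon\in\{-1,1\}^n}p_v(\varepsilon)\,\Gamma_W(\varepsilon;v).$$ *)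

(* Defs.v *)
From HB Require Import structures.
From mathcomp Require Import all_boot all_order all_algebra.
From mathcomp Require Import all_classical all_reals all_analysis.
From mathcomp Require Import ring.

Set Implicit Arguments.
Unset Strict Implicit.
Unset Printing Implicit Defensive.

Import Order.TTheory GRing.Theory Num.Theory.

Local Open Scope classical_set_scope.
Local Open Scope ring_scope.

Definition sigma (R : realType) (t : R) : R := 1 / (1 + expR (- t)).

(* {-1,1}^n is encoded as boolean vectors, with true for 1 and false for -1. *)
Definition cube (n : nat) := {ffun 'I_n -> bool}.

Definition sign (R : realType) (b : bool) : R := if b then 1 else -1.

Definition pmf (R : realType) (n : nat) (v : 'rV[R]_n) (eps : cube n) : R :=
  \prod_(i < n) sigma (sign R (eps i) * v 0 i).

(* [sup] is the real-valued supremum, with junk value 0 when it does not exist;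
   the set below is nonempty and bounded above (lemma Gamma_has_sup). *)
Definition Gamma (R : realType) (n : nat) (W : {vspace 'rV[R]_n})
    (eps : cube n) (v : 'rV[R]_n) : R :=
  sup [set ln (pmf w eps / pmf v eps) | w in [set` W]].

Definition expected_Gamma (R : realType) (n : nat) (v : 'rV[R]_n)
    (W : {vspace 'rV[R]_n}) : R :=
  \sum_(eps : cube n) pmf v eps * Gamma W eps v.

Lemma sigma_gt0 (R : realType) (t : R) : 0 < sigma t.
Proof. by rewrite divr_gt0 ?addr_gt0 ?expR_gt0. Qed.

Lemma sigma_le1 (R : realType) (t : R) : sigma t <= 1.
Proof.
by rewrite /sigma ler_pdivrMr ?addr_gt0 ?expR_gt0 // mul1r lerDl expR_ge0.
Qed.

Lemma sigmaDN (R : realType) (t : R) : sigma t + sigma (- t) = 1.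
Proof.
have e0 := expR_gt0 t.
by rewrite /sigma opprK expRN; field; rewrite !gt_eqF ?addr_gt0.
Qed.

Lemma pmf_gt0 (R : realType) (n : nat) (v : 'rV[R]_n) (eps : cube n) :
  0 < pmf v eps.
Proof. by apply: prodr_gt0 => i _; exact: sigma_gt0. Qed.

Lemma pmf_le1 (R : realType) (n : nat) (v : 'rV[R]_n) (eps : cube n) :
  pmf v eps <= 1.
Proof.
by apply: prodr_ile1 => i; rewrite (ltW (sigma_gt0 _)) sigma_le1.
Qed.

Lemma pmf_sum1 (R : realType) (n : nat) (v : 'rV[R]_n) :
  \sum_(eps : cube n) pmf v eps = 1.
Proof.
rewrite -(bigA_distr_bigA (fun i b => sigma (sign R b * v 0 i))) big1 // => i _.
by rewrite big_bool /sign mul1r mulN1r; exact: sigmaDN.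
Qed.

Lemma Gamma_has_sup (R : realType) (n : nat) (W : {vspace 'rV[R]_n})
    (eps : cube n) (v : 'rV[R]_n) :
  has_sup [set ln (pmf w eps / pmf v eps) | w in [set` W]].
Proof.
split; first by exists (ln (pmf 0 eps / pmf v eps)), 0 => //=; exact: mem0v.
exists (ln (1 / pmf v eps)) => _ [w _ <-].
rewrite ler_ln ?posrE ?divr_gt0 ?pmf_gt0 //.
by rewrite ler_pM2r ?invr_gt0 ?pmf_gt0 // pmf_le1.
Qed.

(* Main.v *)
(** Split the coordinates into K blocks, K about sqrt(ln ln n), such that under
    p_v each block has expected number 1/K of coordinates with eps_i = -1.
    With probability bounded below there is exactly one such coordinate.  A
    two-dimensional W suffices to raise the rate of the affected block k from
    1/K to 1, a gain of ln K, at bounded cost in the other blocks: the points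
    of block k are (a_k, k a_k), and the linear form (k + 1) X - Y takes the
    values (k + 1 - j) a_j on block j, which are nonpositive for j > k and
    negligible against a_k for j < k because a_j = K^j ln K grows
    geometrically.  The block sizes K^(K^k - 1) = e^(a_k) / K then fit into n
    coordinates as soon as K^2 <= ln ln n. *)
Require Import Defs.
From HB Require Import structures.
From mathcomp Require Import all_boot all_order all_algebra.
From mathcomp Require Import all_classical all_reals all_analysis.
From mathcomp Require Import ring lra zify.

(* Restores [pmf], shadowed by the one of MathComp-Analysis. *)
Import Defs.

Import Order.TTheory GRing.Theory Num.Theory.

Local Open Scope ring_scope.

Definition surprise (n : nat) (i : 'I_n) : cube n := [ffun j => j != i].

Lemma surprise_inj (n : nat) : injective (@surprise n).
Proof.
by move=> i j /ffunP /(_ i); rewrite !ffunE eqxx => /esym/negbFE/eqP.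
Qed.

(** Holds because sigma(-t) = e^(-t) sigma(t): flipping one sign to -1 costs the factor e^(-v_i). *)
Lemma pmf_surprise (R : realType) (n : nat) (v : 'rV[R]_n) (i : 'I_n) :
  pmf v (surprise n i) = expR (- v 0 i) * \prod_(j < n) sigma (v 0 j).
Proof.
rewrite /pmf (bigD1 i) //= [in RHS](bigD1 i) //= mulrA; congr (_ * _).
  rewrite ffunE eqxx /= mulN1r /sigma opprK expRN.
  have := expR_gt0 (v 0 i) => v_gt0.
  by field; rewrite !gt_eqF ?addr_gt0.
by apply: eq_bigr => j ji; rewrite ffunE ji mul1r.
Qed.

Lemma prod_sigma_le1 (R : realType) (n : nat) (v : 'rV[R]_n) :
  \prod_(j < n) sigma (v 0 j) <= 1.
Proof. by apply: prodr_ile1 => j; rewrite (ltW (sigma_gt0 _)) sigma_le1. Qed.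

(** Factorwise, 1/sigma(t) = 1 + e^(-t) <= exp(e^(-t)). *)
Lemma prod_sigma_ge (R : realType) (n : nat) (v : 'rV[R]_n) :
  expR (- \sum_(j < n) expR (- v 0 j)) <= \prod_(j < n) sigma (v 0 j).
Proof.
rewrite -sumrN expR_sum; apply: ler_prod => j _; rewrite expR_ge0 /=.
by rewrite [X in X <= _]expRN /sigma div1r lef_pV2 ?posrE ?addr_gt0 ?expR_gt0 ?expR_ge1Dx.
Qed.

(** The ratio is e^(v_i - w_i) times a quotient of products of sigma. The product for [v] is at most
    1 and [prod_sigma_ge] bounds the one for [w], so the subtracted sum is the price of using
    [w]. *)
Lemma ln_pmf_ratio_surprise_ge (R : realType) (n : nat) (v w : 'rV[R]_n)
    (i : 'I_n) :
  v 0 i - w 0 i - \sum_(j < n) expR (- w 0 j)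
    <= ln (pmf w (surprise n i) / pmf v (surprise n i)).
Proof.
rewrite -ler_expR lnK ?posrE ?divr_gt0 ?pmf_gt0 // ler_pdivlMr ?pmf_gt0 //.
rewrite !pmf_surprise; set S := \sum_j _; set P := \prod_j _.
have -> : expR (v 0 i - w 0 i - S) * (expR (- v 0 i) * P) =
    expR (- w 0 i) * (expR (- S) * P).
  by rewrite !mulrA -!expRD; congr (expR _ * _); ring.
rewrite ler_wpM2l ?expR_ge0 //; apply: le_trans (prod_sigma_ge _ _ w).
by rewrite ler_piMr ?expR_ge0 // prod_sigma_le1.
Qed.

Lemma Gamma_ge (R : realType) (n : nat) (W : {vspace 'rV[R]_n}) (eps : cube n)
    (v w : 'rV[R]_n) :
  w \in W -> ln (pmf w eps / pmf v eps) <= Gamma W eps v.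
Proof.
by move=> wW; apply: sup_upper_bound; [exact: Gamma_has_sup | exists w].
Qed.

Lemma Gamma_ge0 (R : realType) (n : nat) (W : {vspace 'rV[R]_n}) (eps : cube n)
    (v : 'rV[R]_n) :
  v \in W -> 0 <= Gamma W eps v.
Proof.
by move=> /(Gamma_ge _ _ _ eps v v); rewrite divff ?ln1 // gt_eqF ?pmf_gt0.
Qed.

(** Only the outcomes with a single -1, placed in [D], are kept; the others contribute nonnegatively
    because [v] itself competes in the supremum. *)
Lemma expected_Gamma_ge (R : realType) (n : nat) (W : {vspace 'rV[R]_n})
    (v : 'rV[R]_n) (D : pred 'I_n) (g : R) :
  v \in W -> 0 <= g ->
  (forall i, D i -> exists2 w, w \in W &
     g <= v 0 i - w 0 i - \sum_(j < n) expR (- w 0 j)) ->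
  (\sum_(i < n | D i) expR (- v 0 i)) *
    (expR (- \sum_(j < n) expR (- v 0 j)) * g) <= expected_Gamma v W.
Proof.
move=> vW g0 hg; rewrite /expected_Gamma.
rewrite (bigID (mem [set surprise n i | i in D])) /= -[leLHS]addr0.
apply: lerD; last first.
  by apply: sumr_ge0 => eps _; rewrite mulr_ge0 ?Gamma_ge0 // ltW ?pmf_gt0.
rewrite big_imset; last by move=> i j _ _; exact: surprise_inj.
rewrite mulr_suml; apply: ler_sum => i Di; rewrite pmf_surprise -mulrA.
rewrite ler_wpM2l ?expR_ge0 // ler_pM ?expR_ge0 ?prod_sigma_ge //.
have [w wW gw] := hg i Di; apply: le_trans gw _.
apply: le_trans (ln_pmf_ratio_surprise_ge _ _ v w i) _; exact: Gamma_ge.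
Qed.

(** Letting [V] and [F] vary records all block sizes at once: real [F] computes weights, and an
    indicator in [nat] shows that a block is nonempty. *)
Lemma block_labels (K n : nat) (m : nat -> nat) :
  (\sum_(k < K) m k <= n)%N ->
  exists b : nat -> nat, forall (V : nmodType) (F : nat -> V),
    \sum_(i < n) F (b i) =
      \sum_(k < K) F k *+ m k + F K *+ (n - \sum_(k < K) m k).
Proof.
move=> mn.
pose s := flatten [seq nseq (m k) k | k <- index_iota 0 K] ++
  nseq (n - \sum_(k < K) m k) K.
have sumE (V : nmodType) (F : nat -> V) : \sum_(k <- s) F k =
    \sum_(k < K) F k *+ m k + F K *+ (n - \sum_(k < K) m k).
  rewrite big_cat /= big_flatten /= big_map big_nseq iter_addr_0 big_mkord.
  by congr (_ + _); apply: eq_bigr => k _; rewrite big_nseq iter_addr_0.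
have ss : size s = n.
  rewrite -sum1_size.
  have := sumE nat (fun=> 1%N); rewrite /= => ->.
  under eq_bigr do rewrite -mulr_natr mul1r natn.
  by rewrite -mulr_natr mul1r natn; exact: subnKC.
exists (nth K s) => V F; rewrite -sumE (big_nth K) ss big_mkord.
by [].
Qed.

Lemma expR1_le4 (R : realType) : expR 1 <= 4 :> R.
Proof.
have h := expR_ge1Dx (- (1 / 2) : R).
have -> : 1 = 1 / 2 + 1 / 2 :> R by lra.
have := expRxMexpNx_1 (1 / 2 : R).
have := expR_gt0 (1 / 2 : R); rewrite expRD; nra.
Qed.

Lemma ln_le_half (R : realType) (x : R) : 0 < x -> ln x <= x / 2.
Proof.
move=> x0; rewrite -ler_expR lnK ?posrE //.
have -> : x / 2 = (x / 2 - 1) + 1 by lra.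
rewrite expRD; have := expR_ge1Dx (x / 2 - 1); have := expR_ge1Dx (1 : R).
nra.
Qed.

(** For j > k the left side is nonpositive. For k = j + e + 1 it remains to see (e + 2) ln K <=
    K^(e+1), which follows from ln K <= K/2 and e + 2 <= 2 K^e. *)
Lemma tilt_le1 (R : realType) (K j k : nat) : (1 < K)%N -> j != k ->
  ((K ^ k)%:R : R)^-1 * ((K ^ j)%:R * ln K%:R * (k.+1%:R - j%:R)) <= 1.
Proof.
move=> K1 jk; have K0 : 0 < K%:R :> R by rewrite ltr0n; lia.
have Kp m : 0 < (K ^ m)%:R :> R by rewrite ltr0n expn_gt0; lia.
have lnK_ge0 : 0 <= ln K%:R :> R by rewrite ln_ge0 // ler1n; lia.
rewrite ler_pdivrMl // mulr1; case: (ssrnat.ltngtP j k) jk => // jk _; last first.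
  apply: le_trans (ltW (Kp k)); rewrite mulr_ge0_le0 ?mulr_ge0 ?(ltW (Kp _)) //.
  by rewrite subr_le0 ler_nat.
have [e ->] : exists e, k = (j + e.+1)%N.
  by exists (k - j.+1)%N; rewrite subnSK // subnKC // ltnW.
rewrite expnD natrM -mulrA ler_wpM2l ?(ltW (Kp _)) //.
have -> : (j + e.+1).+1%:R - j%:R = e.+2%:R :> R.
  by rewrite -addnS -natrB ?leq_addr // addKn.
have he : (e.+2 * K <= K ^ e.+1 * 2)%N.
  rewrite expnSr mulnAC leq_mul2r; apply/orP; right.
  apply: (@leq_trans (2 ^ e * 2)); first by rewrite -expnSr; exact: ltn_expl.
  by rewrite leq_mul2r; case: e => [|e] //=; rewrite leq_exp2r.
move: he; rewrite -(ler_nat R) !natrM => he.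
have := ln_le_half _ _ K0; have e0 : 0 <= e.+2%:R :> R by rewrite ler0n.
nra.
Qed.

Lemma block_weight (R : realType) (K p : nat) : (0 < K)%N -> (0 < p)%N ->
  expR (- (p%:R * ln K%:R)) *+ (K ^ p.-1) = (K%:R : R)^-1.
Proof.
case: p => // p K0 _; have KR : 0 < K%:R :> R by rewrite ltr0n.
rewrite expRN expRM_natl lnK ?posrE //= -[X in X = _]mulr_natr natrX exprS.
by rewrite invfM mulfVK // expf_neq0 // gt_eqF.
Qed.

Lemma sum_block_sizes (K : nat) : (0 < K)%N ->
  (\sum_(k < K) K ^ (K ^ k).-1 <= K ^ (K ^ K.-1))%N.
Proof.
move=> K0; apply: (@leq_trans (\sum_(k < K) K ^ (K ^ K.-1).-1)).
  apply: leq_sum => k _; rewrite leq_pexp2l //.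
  have : (K ^ k <= K ^ K.-1)%N by rewrite leq_pexp2l //; have := ltn_ord k; lia.
  by lia.
rewrite sum_nat_const card_ord -expnS prednK // expn_gt0 K0 //.
Qed.

Lemma expected_Gamma_blocks_ge (R : realType) (K n : nat) :
  (1 < K)%N -> (K ^ (K ^ K.-1) <= n)%N -> 6 <= ln K%:R :> R ->
  exists (W : {vspace 'rV[R]_n}) (v : 'rV[R]_n),
    [/\ \dim W = 2%N,
        v \in W
      & expR (- 2) * (ln K%:R - 6) <= expected_Gamma v W].
Proof.
move=> K1 Kn lnK6; have K0 : (0 < K)%N by exact: ltnW.
have KR : 0 < K%:R :> R by rewrite ltr0n.
have KX p : 0 < (K ^ p)%:R :> R by rewrite ltr0n expn_gt0 K0.
have n0 : 0 < n%:R :> R.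
  by rewrite ltr0n; apply: leq_trans Kn; rewrite expn_gt0 K0.
have invK : K%:R^-1 *+ K = 1 :> R.
  by rewrite -[LHS]mulr_natr mulVf ?gt_eqF.
pose m k := (K ^ (K ^ k).-1)%N.
have mn : (\sum_(k < K) m k <= n)%N by exact: leq_trans (sum_block_sizes K K0) Kn.
have [b sumb] := block_labels K n m mn.
have hit (k : 'I_K) : exists i : 'I_n, b i = k.
  have [/existsP[i /eqP bi]|/existsPn bk] := boolP [exists i : 'I_n, b i == k].
    by exists i.
  (* If no coordinate had label [k], counting the label would give 0 = [m k], but [m k] is a power
     of K > 0. *)
  have := sumb nat (fun j => (j == k) : nat); rewrite big1; last first.
    by move=> i _; rewrite (negbTE (bk i)).
  rewrite (bigD1 k) //= eqxx => /esym/eqP; rewrite !addn_eq0 => /andP[/andP[]].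
  by rewrite -mulr_natr mul1r natn expn_eq0 eqn0Ngt K0.
(* Label K marks the leftover coordinates, which are made almost certain. *)
pose a j : R := if (j < K)%N then (K ^ j)%:R * ln K%:R else ln n%:R.
have aE j : (j < K)%N -> a j = (K ^ j)%:R * ln K%:R by rewrite /a => ->.
have a0 j : (j < K)%N -> a j != 0.
  by move=> jK; rewrite aE // mulf_neq0 ?gt_eqF // (lt_le_trans _ lnK6).
have aK : a K = ln n%:R by rewrite /a ltnn.
have wt j : (j < K)%N -> expR (- a j) *+ m j = K%:R^-1.
  by move=> jK; rewrite aE // block_weight // expn_gt0 K0.
have wtK : expR (- a K) *+ (n - \sum_(k < K) m k) <= 1.
  rewrite aK expRN lnK ?posrE // -[leLHS]mulr_natl ler_pdivrMr // mul1r ler_nat.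
  exact: leq_subr.
pose x : 'rV[R]_n := \row_i a (b i).
pose y : 'rV[R]_n := \row_i (a (b i) * (b i)%:R).
pose W : {vspace 'rV[R]_n} := <<[:: x; y]>>%VS.
have xW : x \in W by apply: memv_span; rewrite !inE eqxx.
have yW : y \in W by apply: memv_span; rewrite !inE eqxx orbT.
(* The K blocks weigh 1/K each and the leftover at most 1; this is the 2 in e^(-2). *)
have sumx : \sum_(i < n) expR (- x 0 i) <= 2.
  under eq_bigr do rewrite mxE.
  rewrite (sumb R (fun j => expR (- a j))).
  under eq_bigr => k _ do rewrite wt //.
  rewrite sumr_const card_ord invK.
  by move: wtK; lra.
have sumxD : \sum_(i < n | (b i < K)%N) expR (- x 0 i) = 1.
  rewrite big_mkcond /=; under eq_bigr do rewrite mxE.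
  rewrite (sumb R (fun j => if (j < K)%N then expR (- a j) else 0)) ltnn mul0rn.
  under eq_bigr => k _ do rewrite ltn_ord wt //.
  by rewrite sumr_const card_ord invK addr0.
exists W, x; split=> //.
  (* On block 0, [y] vanishes and [x] does not, so [x] is no multiple of [y]; on block 1, [y] is
     nonzero. *)
  apply/eqP; rewrite -[2%N]/(size [:: x; y]) -/(free _) free_cons span_seq1.
  rewrite seq1_free; apply/andP; split.
    apply/vlineP => -[c /rowP xy]; have [i bi] := hit (Ordinal K0).
    move: (xy i); rewrite !mxE bi /= !mulr0 => /eqP.
    by rewrite (negbTE (a0 _ K0)).
  apply/eqP => /rowP y0; have [i bi] := hit (Ordinal K1).
  by move: (y0 i); rewrite !mxE bi /= mulr1 => /eqP; rewrite (negbTE (a0 _ K1)).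
have g0 : 0 <= ln K%:R - 6 :> R by rewrite subr_ge0.
apply: le_trans (expected_Gamma_ge _ _ _ _ (fun i => (b i < K)%N) _ xW g0 _).
  by rewrite sumxD mul1r ler_wpM2r // ler_expR lerN2.
move=> i; set k := b i => kK.
(* This scale makes the tilt on block k exactly ln K, raising its weight from 1/K to 1. *)
pose t : R := (K ^ k)%:R^-1.
pose f j : R := t * (a j * (k.+1%:R - j%:R)).
have fk : f k = ln K%:R.
  by rewrite /f /t aE // -natrB // subSnn mulr1 mulKf // gt_eqF.
have wE l : (x - t *: (k.+1%:R *: x - y)) 0 l = a (b l) - f (b l).
  by rewrite !mxE /f; ring.
exists (x - t *: (k.+1%:R *: x - y)).
  by rewrite rpredB // rpredZ // rpredB // rpredZ.
rewrite wE fk mxE -/k opprB addrCA subrr addr0 lerD2l lerN2.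
under eq_bigr do rewrite wE.
rewrite (sumb R (fun j => expR (- (a j - f j)))).
(* As k + 1 <= K, the form is nonpositive on label [K] too, so the tilt cannot increase the leftover
   weight. *)
have leK : expR (- (a K - f K)) *+ (n - \sum_(k < K) m k) <= 1.
  apply: le_trans wtK; apply: ler_wMn2r; rewrite ler_expR lerN2 lerBrDr gerDl.
  rewrite /f mulr_ge0_le0 ?invr_ge0 ?(ltW (KX _)) // aK mulr_ge0_le0 //.
    by rewrite ln_ge0 // ler1n -(ltr0n R).
  by rewrite subr_le0 ler_nat.
have lej (j : 'I_K) : expR (- (a j - f j)) *+ m j <=
    K%:R^-1 * 4 + (if (j : nat) == k then 1 else 0).
  rewrite opprB addrC expRD -mulrnAl wt //; have [->|jk] := eqVneq (j : nat) k.
    by rewrite fk lnK ?posrE // mulVf ?gt_eqF // lerDr mulr_ge0 // invr_ge0 ltW.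
  rewrite addr0 ler_wpM2l ?invr_ge0 ?ler0n //; apply: le_trans (expR1_le4 R).
  by rewrite ler_expR /f aE // tilt_le1.
(* The 6 arises as 4 from K blocks at e/K <= 4/K each, 1 from block k and 1 from the leftover. *)
apply: (@le_trans _ _ (\sum_(j < K) (K%:R^-1 * 4 +
    (if (j : nat) == k then 1 else 0)) + 1)).
  by apply: lerD => //; apply: ler_sum => j _.
rewrite big_split /= sumr_const card_ord -mulrnAl invK.
rewrite -big_mkcond (big_pred1 (Ordinal kK)) //=.
lra.
Qed.

Theorem proposition4p1 (R : realType) (n : nat)
    (hn : Num.ceil (expR (expR (expR (20 : R)))) <= n%:Z) :
  exists (W : {vspace 'rV[R]_n}) (v : 'rV[R]_n),
    [/\ \dim W = 2%N,
        v \in W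
      & 1 / (16 * expR 1 ^+ 2) * ln (ln (ln n%:R)) <= expected_Gamma v W].
Proof.
have n_ge : expR (expR (expR 20)) <= n%:R :> R.
  by apply: le_trans (ceil_ge _) _; rewrite -[n%:R]/(n%:Z%:~R) ler_int.
have n0 : 0 < n%:R :> R by apply: lt_le_trans n_ge; exact: expR_gt0.
have n1_ge : expR (expR 20) <= ln n%:R :> R by rewrite -ler_expR lnK ?posrE.
have n1 : 0 < ln n%:R :> R by apply: lt_le_trans n1_ge; exact: expR_gt0.
have n2_ge : expR 20 <= ln (ln n%:R) :> R by rewrite -ler_expR lnK ?posrE.
have n2 : 0 < ln (ln n%:R) :> R by apply: lt_le_trans n2_ge; exact: expR_gt0.
set L := ln (ln (ln n%:R)).
have L20 : 20 <= L :> R by rewrite -ler_expR lnK ?posrE.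
pose K := Num.truncn (expR (L / 2)).
have /andP[KL LK] := truncn_itv (expR_ge0 (L / 2)); rewrite -/K in KL LK.
have K10 : (10 < K.+1)%N.
  by rewrite -(ltr_nat R); have := expR_ge1Dx (L / 2); lra.
have K1 : (1 < K)%N by lia.
have KR : 1 < K%:R :> R by rewrite ltr1n.
(* Rounding down loses at most a factor e: e^(L/2) < K + 1 <= 2K <= eK. *)
have lnKL : L / 2 - 1 <= ln K%:R.
  rewrite -ler_expR lnK ?posrE; last by lra.
  rewrite expRB ler_pdivrMr ?expR_gt0 //.
  have := expR_ge1Dx (1 : R); move: LK; rewrite -natr1; nra.
(* Two logarithms and ln K <= K reduce this to K^2 <= e^L = ln ln n. *)
have Kn : (K ^ (K ^ K.-1) <= n)%N.
  have K0 : (K%:R : R) \is Num.pos by rewrite posrE (lt_trans ltr01).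
  have lnKK : ln K%:R <= K%:R :> R by apply/ltW/ln_sublinear/(lt_trans ltr01).
  have XE (p : nat) : (K ^ p)%:R = expR (p%:R * ln K%:R) :> R.
    by rewrite expRM_natl lnK // natrX.
  rewrite -(ler_nat R) XE -[n%:R]lnK // ler_expR.
  apply: (@le_trans _ _ (K ^ K)%:R).
    rewrite (_ : K ^ K = K ^ K.-1 * K)%N; last by rewrite -expnSr prednK // ltnW.
    by rewrite natrM ler_wpM2l ?ler0n.
  rewrite XE -[ln n%:R]lnK // ler_expR -[ln (ln _)]lnK // -/L.
  have -> : L = L / 2 + L / 2 by lra.
  by rewrite expRD; apply: ler_pM => //; [lra | exact: le_trans KL].
have [|W [v [dW vW E]]] := expected_Gamma_blocks_ge R K n K1 Kn; first by lra.
exists W, v; split => //; apply: le_trans E.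
have e2 : expR 2 = expR 1 ^+ 2 :> R by rewrite -expRM_natl mulr1.
rewrite expRN e2 div1r invfM -mulrA mulrCA ler_wpM2l ?invr_ge0 ?sqr_ge0 //.
(* Here ln K - 6 >= L/2 - 7 >= L/16, since L >= 20. *)
lra.
Qed.
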